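(* Let $n\ge1$ and let $A_n=(a_1,\ldots,a_n)$ be a regular discount sequence. Let $F$ be a probability distribution on $\mathbf{R}$ with a finite mean and let $0<M<\tilde M$. Then the break-even values satisfy $$\Lambda(MF;A_n)\ge\Lambda(\tilde MF;A_n).$$
   Context: All measures are Borel measures on $\mathbf{R}$; a measure $\alpha$ has a finite first moment (finite mean) if $\int |x|\,d\alpha(x)<\infty$. $\delta_x$ is the point mass at $x$. A discount sequence is $A_n=(a_1,\ldots,a_n)$ with $a_i\ge0$ and $\sum_{i=1}^n a_i>0$. Dirichlet bandit $(\alpha_1,\alpha_2;A_n)$: at each of $n$ stages one of two arms is selected, sequentially, based on past observations. Observations from arm $i$ are independent draws from $P_i$ given $P_i$, where $P_1,P_2$ are independent random probability measures, $P_i$ having a Dirichlet process prior ${\rm DP}(\alpha_i)$, with $\alpha_i$ a finite nonnull measure with finite first moment. The payoff is $\sum_{i=1}^n a_iZ_i$, where $Z_i$ is the observation at stage $i$. $W(\alpha_1,\alpha_2;A_n)$ denotes the maximum expected payoff over all strategies, and $W^i(\alpha_1,\alpha_2;A_n)$ the expected payoff when arm $i$ is selected initially and an optimal strategy is used thereafter. Equivalently (for all finite sequences of nonnegative reals): $W=0$ for the empty sequence, and for $n\ge1$, with $A_n^1=(a_2,\ldots,a_n)$, $$W(\alpha_1,\alpha_2;A_n)=\max\{W^1(\alpha_1,\alpha_2;A_n),W^2(\alpha_1,\alpha_2;A_n)\},$$ $$W^1(\alpha_1,\alpha_2;A_n)=a_1\mu_1+E[W(\alpha_1+\delta_X,\alpha_2;A_n^1)\,|\,\alpha_1],$$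 $$W^2(\alpha_1,\alpha_2;A_n)=a_1\mu_2+E[W(\alpha_1,\alpha_2+\delta_Y;A_n^1)\,|\,\alpha_2],$$ where $E[g(X)|\alpha]$ means that $X$ has distribution $\alpha/\alpha(\mathbf{R})$, and $\mu_i=\int x\,d\alpha_i(x)/\alpha_i(\mathbf{R})$. Arm $i$ is optimal initially if $W=W^i$. One-armed bandit: $(\alpha,\delta_\lambda;A_n)$ with $\lambda\in\mathbf{R}$; arm 2 yields the constant payoff $\lambda$ at each stage. Regular: with the convention $a_i=0$ for $i>n$, the sequence $A_n$ is regular if $(\sum_{i\ge j+1}a_i)^2\ge(\sum_{i\ge j}a_i)(\sum_{i\ge j+2}a_i)$ for all $j\ge1$. Break-even value: for $A_n$ regular, $\Lambda(\alpha;A_n)$ denotes the (necessarily unique) real number such that, for every $\lambda\in\mathbf{R}$, in the $(\alpha,\delta_\lambda;A_n)$ bandit arm 1 is optimal initially if and only if $\lambda\le\Lambda(\alpha;A_n)$, and arm 2 is optimal initially if and only if $\lambda\ge\Lambda(\alpha;A_n)$. (The existence of the break-even value is taken as known.) *)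

(* Defs.v *)
From HB Require Import structures.
From mathcomp Require Import all_boot all_order all_algebra.
From mathcomp Require Import all_classical all_reals all_analysis.
Set Implicit Arguments.
Unset Strict Implicit.
Unset Printing Implicit Defensive.
Import Order.TTheory GRing.Theory Num.Theory.
Local Open Scope classical_set_scope.
Local Open Scope ring_scope.

(* MathComp-Analysis; all measures are Borel measures on R. *)
Notation borel_measure R := {measure set (measurableTypeR R) -> \bar R}.

Section bandit.
Context {R : realType}.
Implicit Types (alpha : borel_measure R) (A : seq R).

Definition add_point alpha (x : R) : borel_measure R :=
  measure_add alpha (@dirac _ (measurableTypeR R) x R).

(* E[g(X) | alpha], where X has distribution alpha / alpha(R): the integral
   against the normalized measure is the normalized integral. *)
Definition expect alpha (g : R -> R) : R :=
  (\int[alpha]_x g x) / fine (alpha setT).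

Definition mean alpha : R := expect alpha id.

(* The current discount factor is a, and V gives the optimal value of the
   remaining stages as a function of the two updated parameter measures. *)
Definition select1 (V : borel_measure R -> borel_measure R -> R) (a : R)
    alpha1 alpha2 : R :=
  a * mean alpha1 + expect alpha1 (fun x => V (add_point alpha1 x) alpha2).

Definition select2 (V : borel_measure R -> borel_measure R -> R) (a : R)
    alpha1 alpha2 : R :=
  a * mean alpha2 + expect alpha2 (fun y => V alpha1 (add_point alpha2 y)).

Fixpoint W A alpha1 alpha2 : R :=
  if A is a :: A' then
    Num.max (select1 (W A') a alpha1 alpha2) (select2 (W A') a alpha1 alpha2)
  else 0.

Definition W1 A alpha1 alpha2 : R :=
  if A is a :: A' then select1 (W A') a alpha1 alpha2 else 0.

Definition W2 A alpha1 alpha2 : R :=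
  if A is a :: A' then select2 (W A') a alpha1 alpha2 else 0.

Definition arm1_optimal A alpha1 alpha2 : Prop :=
  W A alpha1 alpha2 = W1 A alpha1 alpha2.

Definition arm2_optimal A alpha1 alpha2 : Prop :=
  W A alpha1 alpha2 = W2 A alpha1 alpha2.

Definition discount_sequence A : Prop :=
  (forall i, (i < size A)%N -> 0 <= A`_i) /\ 0 < \sum_(0 <= i < size A) A`_i.

(* Indices start at 0: the j-th tail is a_{j+1} + a_{j+2} + ..., which is 0
   for j >= size A. *)
Definition tail_sum A (j : nat) : R := \sum_(j <= i < size A) A`_i.

Definition regular A : Prop :=
  forall j : nat, tail_sum A j.+1 ^+ 2 >= tail_sum A j * tail_sum A j.+2.

(* L = Lambda(alpha; A). Since lambda ranges over all of R, at most one L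
   satisfies this. *)
Definition is_break_even alpha A (L : R) : Prop :=
  forall lambda : R,
    let delta := @dirac _ (measurableTypeR R) lambda R in
    (arm1_optimal A alpha delta <-> lambda <= L) /\
    (arm2_optimal A alpha delta <-> lambda >= L).

End bandit.

(* Main.v *)
Require Import Defs.
From HB Require Import structures.
From mathcomp Require Import all_boot all_order all_algebra.
From mathcomp Require Import all_classical all_reals all_analysis.
From mathcomp Require Import measurable_realfun ring lra.
Set Implicit Arguments.
Unset Strict Implicit.
Unset Printing Implicit Defensive.
Import Order.TTheory GRing.Theory Num.Theory.
Local Open Scope classical_set_scope.
Local Open Scope ring_scope.

(** Write [W alpha] for the optimal value as a function of the parameter of the
    first arm.  Two facts about it are proved for an arbitrary second arm and
    arbitrary discounting, both by induction on the horizon.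

    Splitting ([split_convex_W]).  If a part [eta] of the parameter
    [gamma + eta] is gathered into a single atom of the same mass [d], placed
    at a random point [Z] drawn from [eta / d], then the value can only
    increase on average:
      [W (gamma + eta) <= E W (gamma + d delta_Z)].
    After pulling the arm, an observation [y] coming from [gamma] leaves the
    comparison unchanged, with [gamma + delta_y] in place of [gamma].  An
    observation [y] coming from [eta] leaves [gamma + (eta + delta_y)], and
    the induction hypothesis is applied to the larger part [eta + delta_y];
    the resulting random atom has position drawn from
    [(eta + delta_y) / (d + 1)], which, averaged over [y], is again distributed
    as [Z], and its mass [d + 1] is what the atom [d delta_Z] weighs once [Z]
    itself has been observed.

    Scaling ([scaling_decreasing_W]).  For [k > 1], [W (k alpha) <= W alpha]:
    for a given predictive distribution, more prior mass is worth less.  After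
    an observation [x] the heavy arm is at [k alpha + delta_x], which is
    [k' > 1] times [alpha + eta_x], with [eta_x] a mixture of the normalized
    [alpha] and of [delta_x], of total mass one.  The induction hypothesis
    removes [k']; splitting bounds [W (alpha + eta_x)] by the average of
    [W (alpha + delta_z)] over [z] drawn from [eta_x]; and when [x] is averaged
    out, [z] has the law of one observation from [alpha].

    For the break-even values the second arm pays a known [lambda].  When the
    discount sequence is regular the one-armed bandit is a stopping problem
    ([W_excess]): if it is not optimal to pull the unknown arm, then
    [W = lambda (a_1 + .. + a_n)], whereas this quantity is a lower bound for
    the payoff of starting with the known arm in every case.  For
    [L < lambda < L'] the unknown arm is not optimal at [M F], hence
    [W (M' F) <= W (M F) = lambda (a_1 + .. + a_n) <= W2 (M' F)], so the known
    arm is optimal for [M' F], which contradicts [lambda < L']. *)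

Local Notation point x := (@dirac _ (measurableTypeR _) x _).

(** * Real integrals against sums and multiples of measures and point masses *)

Section integrals.
Context {R : realType}.
Implicit Types (alpha beta : borel_measure R) (g h : R -> R).

Definition integ alpha g := alpha.-integrable [set: R] (EFin \o g).

Definition addm alpha beta : borel_measure R := measure_add alpha beta.

Definition mass alpha : R := fine (alpha setT).

Lemma measure_ext alpha beta : (forall U, alpha U = beta U) -> alpha = beta.
Proof. by move=> ab; apply: eq_measure; apply/funext. Qed.

Lemma addmE alpha beta U : addm alpha beta U = (alpha U + beta U)%E.
Proof. exact: measure_addE. Qed.

Lemma integ_measurable alpha g : integ alpha g -> measurable_fun [set: R] g.
Proof. by move=> /(measurable_int alpha) /measurable_EFinP. Qed.

Lemma integ_addm alpha beta g :
  integ alpha g -> integ beta g -> integ (addm alpha beta) g.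
Proof.
move=> /integrableP[mg ga] /integrableP[_ gb]; apply/integrableP; split => //.
rewrite ge0_integral_measure_add//; last exact: measurableT_comp.
exact: lte_add_pinfty.
Qed.

Lemma Rintegral_addm alpha beta g :
  integ alpha g -> integ beta g ->
  \int[addm alpha beta]_x g x = \int[alpha]_x g x + \int[beta]_x g x.
Proof.
move=> ga gb; rewrite /Rintegral integral_measure_add//.
by rewrite fineD//; exact: integrable_fin_num.
Qed.

Lemma integ_dirac (x : R) g : measurable_fun [set: R] g ->
  integ (point x) g.
Proof.
move=> mg; apply/integrableP; split; first exact/measurable_EFinP.
rewrite integral_dirac//; last first.
  by apply: measurableT_comp => //; exact/measurable_EFinP.
by rewrite diracE mem_set// mul1e ltry.
Qed.

Lemma Rintegral_dirac (x : R) g : measurable_fun [set: R] g ->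
  \int[point x]_y g y = g x.
Proof.
move=> mg; rewrite /Rintegral integral_dirac//; last exact/measurable_EFinP.
by rewrite diracE mem_set// mul1e.
Qed.

Lemma integ_mscale (c : {nonneg R}) alpha g :
  integ alpha g -> integ (mscale c alpha) g.
Proof.
move=> /integrableP[mg ga]; apply/integrableP; split => //.
rewrite ge0_integral_mscale//; last exact: measurableT_comp.
by rewrite lte_mul_pinfty// lee_fin.
Qed.

Lemma Rintegral_mscale (c : {nonneg R}) alpha g : integ alpha g ->
  \int[mscale c alpha]_x g x = c%:num * \int[alpha]_x g x.
Proof.
move=> ga; rewrite /Rintegral.
have mg := measurable_int alpha ga.
rewrite integralE ge0_integral_mscale//; last exact: measurable_funepos.
rewrite ge0_integral_mscale//; last exact: measurable_funeneg.
have Pf := integrable_pos_fin_num measurableT ga.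
have Nf := integrable_neg_fin_num measurableT ga.
rewrite [in RHS]integralE -muleBr// ?fin_num_adde_defl ?fin_numN//.
by rewrite fineM// fin_numB Pf Nf.
Qed.

Lemma integD alpha g h : integ alpha g -> integ alpha h ->
  integ alpha (fun x => g x + h x).
Proof. by move=> ga ha; apply: (integrableD measurableT ga ha). Qed.

Lemma integZ alpha c g : integ alpha g -> integ alpha (fun x => c * g x).
Proof. by move=> ga; apply: (integrableZl measurableT c ga). Qed.

Lemma integ_cst alpha c : (alpha setT < +oo)%E -> integ alpha (fun=> c).
Proof.
move=> fa; apply/integrableP; split; first exact: measurable_cst.
by rewrite integral_cst//= lte_mul_pinfty.
Qed.

Lemma le_integ alpha g h : measurable_fun [set: R] g -> integ alpha h ->
  (forall x, `|g x| <= h x) -> integ alpha g.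
Proof.
move=> mg ha gh; apply: (le_integrable measurableT _ _ ha).
  exact/measurable_EFinP.
by move=> x _ /=; rewrite lee_fin (le_trans (gh x))// ler_norm.
Qed.

End integrals.

(** * Families of measures depending measurably on a parameter *)

(** The total mass does not depend on the parameter, so that dividing by it
    raises no question of measurability. *)
Definition equimass_kernel (R : realType) d (T : measurableType d)
    (kappa : T -> borel_measure R) : Prop :=
  (forall U, measurable U -> measurable_fun [set: T] (kappa ^~ U)) /\
  exists m : R, forall t, kappa t setT = m%:E.

Section kernels.
Context {R : realType}.

Lemma kernel_integral d (T : measurableType d) (kappa : T -> borel_measure R)
    (f : T * measurableTypeR R -> \bar R) :
  equimass_kernel kappa -> (forall z, 0 <= f z)%E -> measurable_fun setT f ->
  measurable_fun [set: T] (fun t => \int[kappa t]_x f (t, x))%E.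
Proof.
move=> [mk [m km]] f0 mf.
have kuub : measure_fam_uub kappa.
  by exists (m + 1) => t; rewrite km lte_fin ltrDl.
pose H1 := isKernel.Build _ _ _ _ _ kappa mk.
pose k0 : R.-ker T ~> measurableTypeR R := HB.pack kappa H1.
pose H2 := Kernel_isFinite.Build _ _ _ _ _ (Kernel.sort k0) kuub.
pose k : R.-fker T ~> measurableTypeR R := HB.pack (Kernel.sort k0) H2.
exact: (measurable_fun_integral_finite_kernel f k).
Qed.

Lemma kernel_expect d (T : measurableType d) (kappa : T -> borel_measure R)
    (f : T * measurableTypeR R -> R) :
  equimass_kernel kappa -> measurable_fun setT f ->
  measurable_fun [set: T] (fun t => expect (kappa t) (fun x => f (t, x))).
Proof.
move=> ek mf; have [_ [m km]] := ek.
have mF : measurable_fun setT (EFin \o f) by exact/measurable_EFinP.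
rewrite /expect (_ : (fun t => _) =
    (fun t => \int[kappa t]_x f (t, x) * m^-1)); last first.
  by apply/funext => t; rewrite km.
apply: measurable_funM; last exact: measurable_cst.
rewrite /Rintegral.
apply: (measurableT_comp (fine_measurable measurableT)).
rewrite (_ : (fun t => _) = (fun t =>
  \int[kappa t]_x ((EFin \o f)^\+ (t, x)) -
  \int[kappa t]_x ((EFin \o f)^\- (t, x)))%E); last first.
  apply/funext => t; rewrite integralE.
  by congr (_ - _)%E; apply: eq_integral => x _; rewrite ?funeposE ?funenegE.
apply: emeasurable_funB; apply: kernel_integral => //.
  exact: measurable_funepos.
exact: measurable_funeneg.
Qed.

Lemma kernel_comp d d' (S : measurableType d) (T : measurableType d')
    (h : S -> T) (kappa : T -> borel_measure R) :
  measurable_fun setT h -> equimass_kernel kappa ->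
  equimass_kernel (kappa \o h).
Proof.
move=> mh [mk [m km]]; split; last by exists m => s; exact: km.
by move=> U mU; exact: (measurableT_comp (mk _ mU) mh).
Qed.

Lemma kernel_cst d (T : measurableType d) (alpha : borel_measure R) :
  (alpha setT < +oo)%E -> equimass_kernel (fun _ : T => alpha).
Proof.
move=> fa; split; first by move=> U mU; exact: measurable_cst.
by exists (mass alpha) => _; rewrite /mass fineK// ge0_fin_numE.
Qed.

Lemma kernel_dirac d (T : measurableType d) (h : T -> R) :
  measurable_fun [set: T] h ->
  equimass_kernel (fun t => point (h t)).
Proof.
move=> mh; split; last by exists 1 => t; exact: diracT.
by move=> U mU; exact: (measurableT_comp (measurable_fun_dirac mU) mh).
Qed.

Lemma kernel_add d (T : measurableType d) (k1 k2 : T -> borel_measure R) :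
  equimass_kernel k1 -> equimass_kernel k2 ->
  equimass_kernel (fun t => addm (k1 t) (k2 t)).
Proof.
move=> [mk1 [m1 km1]] [mk2 [m2 km2]]; split.
  move=> U mU; rewrite (_ : (fun t => _) = (fun t => k1 t U + k2 t U)%E).
    by apply: emeasurable_funD; [exact: mk1|exact: mk2].
  by apply/funext => t; exact: addmE.
exists (m1 + m2) => t; apply: etrans (addmE _ _ _) _.
by rewrite km1 km2.
Qed.

Lemma kernel_scale d (T : measurableType d) (c : {nonneg R})
    (k : T -> borel_measure R) :
  equimass_kernel k -> equimass_kernel (fun t => mscale c (k t)).
Proof.
move=> [mk [m km]]; split.
  by move=> U mU; apply: measurable_funeM; exact: mk.
by exists (c%:num * m) => t; rewrite /= /mscale/= km EFinM.
Qed.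

Lemma kernel_add_point d (T : measurableType d) (k : T -> borel_measure R)
    (h : T -> R) :
  equimass_kernel k -> measurable_fun [set: T] h ->
  equimass_kernel (fun t => add_point (k t) (h t)).
Proof. by move=> ek mh; apply: kernel_add => //; exact: kernel_dirac. Qed.

End kernels.

(** * Expectation under the normalized measure *)

Section expectation.
Context {R : realType}.
Implicit Types (alpha beta : borel_measure R) (g h : R -> R).

(** The parameters of a Dirichlet process arm: finite, nonnull, and with a
    finite first moment. *)
Definition finite_mean alpha : Prop :=
  [/\ (alpha setT < +oo)%E, 0 < mass alpha & integ alpha id].

Definition absmean alpha : R := expect alpha (fun x => `|x|).

Lemma integ_norm alpha g : integ alpha g -> integ alpha (fun x => `|g x|).
Proof. exact: integrable_norm. Qed.

Lemma mass_add alpha beta : (alpha setT < +oo)%E -> (beta setT < +oo)%E ->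
  mass (addm alpha beta) = mass alpha + mass beta.
Proof.
move=> fa fb; by rewrite /mass [X in fine X]addmE fineD ?ge0_fin_numE.
Qed.

Lemma mass_scale (c : {nonneg R}) alpha : (alpha setT < +oo)%E ->
  mass (mscale c alpha) = c%:num * mass alpha.
Proof. by move=> fa; rewrite /mass /= /mscale/= fineM// ge0_fin_numE. Qed.

Lemma mass_point (x : R) : mass (point x) = 1.
Proof. by rewrite /mass [X in fine X]diracT. Qed.

Lemma finite_mean_add alpha beta :
  finite_mean alpha -> finite_mean beta -> finite_mean (addm alpha beta).
Proof.
move=> [fa pa ia] [fb pb ib]; split.
- by rewrite [X in (X < _)%E]addmE lte_add_pinfty.
- by rewrite mass_add// addr_gt0.
- exact: integ_addm.
Qed.

Lemma finite_mean_scale (c : {nonneg R}) alpha : 0 < c%:num ->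
  finite_mean alpha -> finite_mean (mscale c alpha).
Proof.
move=> c0 [fa pa ia]; split.
- by rewrite /= /mscale/= lte_mul_pinfty// lee_fin.
- by rewrite mass_scale// mulr_gt0.
- exact: integ_mscale.
Qed.

Lemma finite_mean_point (x : R) : finite_mean (point x).
Proof.
split; first by rewrite [X in (X < _)%E]diracT ltry.
  by rewrite mass_point.
by apply: integ_dirac; exact: measurable_id.
Qed.

Lemma finite_mean_add_point alpha (x : R) :
  finite_mean alpha -> finite_mean (add_point alpha x).
Proof. by move=> fa; apply: finite_mean_add => //; exact: finite_mean_point. Qed.

Lemma expectD alpha g h : integ alpha g -> integ alpha h ->
  expect alpha (fun x => g x + h x) = expect alpha g + expect alpha h.
Proof. by move=> ga ha; rewrite /expect RintegralD// mulrDl. Qed.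

Lemma expectZ alpha c g : integ alpha g ->
  expect alpha (fun x => c * g x) = c * expect alpha g.
Proof. by move=> ga; rewrite /expect RintegralZl// mulrA. Qed.

Lemma expect_cst alpha c : finite_mean alpha -> expect alpha (fun=> c) = c.
Proof. by move=> [fa pa _]; rewrite /expect Rintegral_cst// mulfK// gt_eqF. Qed.

Lemma le_expect alpha g h : integ alpha g -> integ alpha h ->
  (forall x, g x <= h x) -> expect alpha g <= expect alpha h.
Proof.
move=> ga ha gh; rewrite /expect ler_wpM2r ?invr_ge0 ?fine_ge0//.
by apply: le_Rintegral => // x _.
Qed.

Lemma le_norm_expect alpha g : integ alpha g ->
  `|expect alpha g| <= expect alpha (fun x => `|g x|).
Proof.
move=> ga; rewrite /expect normrM normfV [X in _ / X]ger0_norm ?fine_ge0//.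
by rewrite ler_wpM2r ?invr_ge0 ?fine_ge0// le_normr_Rintegral.
Qed.

Lemma absmean_ge0 alpha : 0 <= absmean alpha.
Proof.
by apply: divr_ge0; [exact: Rintegral_ge0|exact: fine_ge0].
Qed.

Lemma expect_add alpha beta g : finite_mean alpha -> finite_mean beta ->
  integ alpha g -> integ beta g ->
  expect (addm alpha beta) g =
  (mass alpha * expect alpha g + mass beta * expect beta g) /
    (mass alpha + mass beta).
Proof.
move=> [fa pa _] [fb pb _] ga gb.
rewrite /expect -!/(mass _) mass_add// Rintegral_addm//.
by rewrite [mass alpha * _]mulrC [mass beta * _]mulrC !divfK ?gt_eqF.
Qed.

Lemma expect_scale (c : {nonneg R}) alpha g : 0 < c%:num -> finite_mean alpha ->
  integ alpha g -> expect (mscale c alpha) g = expect alpha g.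
Proof.
move=> c0 [fa pa _] ga; rewrite /expect -!/(mass _) mass_scale//.
by rewrite Rintegral_mscale// -mulf_div divff ?mul1r// gt_eqF.
Qed.

Lemma expect_point (x : R) g : measurable_fun [set: R] g ->
  expect (point x) g = g x.
Proof.
by move=> mg; rewrite /expect -/(mass _) mass_point Rintegral_dirac// divr1.
Qed.

Lemma expect_add_point alpha (x : R) g : finite_mean alpha -> integ alpha g ->
  expect (add_point alpha x) g =
  (mass alpha * expect alpha g + g x) / (mass alpha + 1).
Proof.
move=> fa ga; have mg := integ_measurable ga.
rewrite expect_add//; last exact: integ_dirac; last exact: finite_mean_point.
by rewrite mass_point expect_point// mul1r.
Qed.

(** The posterior predictive distributions form a martingale. *)
Lemma expect_predictive alpha g : finite_mean alpha -> integ alpha g ->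
  expect alpha (fun x => expect (add_point alpha x) g) = expect alpha g.
Proof.
move=> fa ga; have [ffa pa _] := fa.
rewrite (_ : (fun x => _) = (fun x =>
    (mass alpha + 1)^-1 * (mass alpha * expect alpha g) +
    (mass alpha + 1)^-1 * g x)); last first.
  by apply/funext => x; rewrite expect_add_point// mulrC mulrDr.
rewrite expectD//; [|exact: integ_cst|exact: integZ].
rewrite expect_cst// expectZ//; field.
by rewrite gt_eqF// addr_gt0.
Qed.

Lemma Rintegral_swap
    (m1 m2 : {finite_measure set (measurableTypeR R) -> \bar R})
    (f : R * R -> R) g h :
  measurable_fun [set: measurableTypeR R * measurableTypeR R] f ->
  integ m1 g -> integ m2 h -> (forall x y, `|f (x, y)| <= g x + h y) ->
  integ m1 (fun x => \int[m2]_y f (x, y)) /\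
  \int[m1]_x \int[m2]_y f (x, y) = \int[m2]_y \int[m1]_x f (x, y).
Proof.
move=> mf ga hb fgh.
have fin (m : {finite_measure set (measurableTypeR R) -> \bar R}) :
  (m setT < +oo)%E.
  exact: (fin_num_fun_lty (fin_num_measure m)).
have sect1 x : integ m2 (fun y => f (x, y)).
  apply: (le_integ _ (h := fun y => g x + h y)) => //.
    exact: (measurableT_comp mf (pair1_measurable _)).
  by apply: integD => //; exact: (integ_cst _ (fin _)).
have sect2 y : integ m1 (fun x => f (x, y)).
  apply: (le_integ _ (h := fun x => g x + h y)) => //.
    exact: (measurableT_comp mf (pair2_measurable _)).
  by apply: integD => //; exact: (integ_cst _ (fin _)).
have intF : (m1 \x m2)%E.-integrable setT (EFin \o f).
  apply/integrable12ltyP; first exact/measurable_EFinP.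
  have gI : integ m1 (fun x => mass m2 * g x + \int[m2]_y h y).
    by apply: integD; [exact: integZ|exact: (integ_cst _ (fin _))].
  apply: le_lt_trans (integrable_lty _ gI) => //.
  apply: ge0_le_integral => //.
  - by move=> x _; exact: integral_ge0.
  - apply: (@measurable_fun_fubini_tonelli_F _ _ _ _ R m2
      (abse \o (EFin \o f))); last first.
      by move=> z; exact: abse_ge0.
    by apply: measurableT_comp => //; exact/measurable_EFinP.
  - by apply/measurable_EFinP; exact: integ_measurable gI.
  - move=> x _.
    have ghI : integ m2 (fun y => g x + h y).
      by apply: integD => //; exact: (integ_cst _ (fin _)).
    apply: (@le_trans _ _ (\int[m2]_y (g x + h y)%:E)%E).
      apply: ge0_le_integral => //.
      + apply: measurableT_comp => //; apply/measurable_EFinP.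
        exact: integ_measurable (sect1 x).
      + by apply/measurable_EFinP; exact: integ_measurable ghI.
      + by move=> y _; rewrite /= lee_fin.
    rewrite -[X in (X <= _)%E]fineK; last exact: integrable_fin_num ghI.
    rewrite -/(Rintegral m2 setT _) RintegralD//;
      last exact: (integ_cst _ (fin _)).
    by rewrite Rintegral_cst// /= [_ * mass _]mulrC.
have E1 x : (\int[m2]_y (f (x, y))%:E = (\int[m2]_y f (x, y))%:E)%E.
  by rewrite fineK//; exact: (integrable_fin_num measurableT (sect1 x)).
have E2 y : (\int[m1]_x (f (x, y))%:E = (\int[m1]_x f (x, y))%:E)%E.
  by rewrite fineK//; exact: (integrable_fin_num measurableT (sect2 y)).
split.
  apply: eq_integrable (integrable_fubini_F intF) => // x _.
  by rewrite /fubini_F E1.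
transitivity (fine (\int[m1]_x \int[m2]_y (f (x, y))%:E)%E).
  by congr fine; apply: eq_integral => x _; rewrite E1.
rewrite (Fubini intF); congr fine; apply: eq_integral => y _.
exact: E2.
Qed.

(** Dominating the integrand by a sum of integrable functions of one variable
    replaces integrability for the product measure. *)
Lemma expect_swap alpha beta (f : R * R -> R) g h :
  finite_mean alpha -> finite_mean beta ->
  measurable_fun [set: measurableTypeR R * measurableTypeR R] f ->
  integ alpha g -> integ beta h -> (forall x y, `|f (x, y)| <= g x + h y) ->
  integ alpha (fun x => expect beta (fun y => f (x, y))) /\
  expect alpha (fun x => expect beta (fun y => f (x, y))) =
  expect beta (fun y => expect alpha (fun x => f (x, y))).
Proof.
move=> fa fb mf.
have restrT (mu : borel_measure R) : (mu setT < +oo)%E ->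
    exists m : {finite_measure set (measurableTypeR R) -> \bar R}, mu = m.
  move=> fm; exists (mfrestr measurableT fm).
  by apply: measure_ext => U; rewrite /= /mfrestr/= /mrestr setIT.
have [[/restrT[a ->] a0 ia] [/restrT[b ->] b0 ib]] := (fa, fb).
move=> ga hb fgh.
have [Ia E] := Rintegral_swap mf ga hb fgh.
have [||Ib _] := @Rintegral_swap b a (fun p => f (p.2, p.1)) _ _ _ hb ga.
- exact: (measurableT_comp mf
    (@measurable_swap _ _ (measurableTypeR R) (measurableTypeR R))).
- by move=> x y; rewrite addrC.
split; last by rewrite /expect !RintegralZr// E mulrAC.
rewrite (_ : (fun x => _) =
    (fun x => (fine (b setT))^-1 * \int[b]_y f (x, y))); first exact: integZ.
by apply/funext => x; rewrite mulrC.
Qed.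

End expectation.

(** * Measurability and growth of the value function *)

Section tame_families.
Context {R : realType}.
Implicit Types (alpha beta gamma eta : borel_measure R) (g h : R -> R).
Implicit Types (V : borel_measure R -> borel_measure R -> R).

(** The gauge [w] measures the size of the parameter; it is an absolute value
    when the parameter is an observation. *)
Definition tame_family d (T : measurableType d) (w : T -> R)
    (k : T -> borel_measure R) : Prop :=
  [/\ equimass_kernel k, forall t, finite_mean (k t) &
      exists K, forall t, absmean (k t) <= K * (1 + w t)].

Definition linear_growth d (T : measurableType d) (w : T -> R) (g : T -> R) :=
  measurable_fun [set: T] g /\ exists K, forall t, `|g t| <= K * (1 + w t).

(** What makes every expectation in the recursion for the value meaningful.
    The bound by mean absolute values propagates through the recursion because
    these, too, are martingales. Measurability is required along all families
    at once: one stage of the recursion adds the observation to the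
    parameters of the family. *)
Definition tame_value V : Prop :=
  (forall d (T : measurableType d) (k1 k2 : T -> borel_measure R),
    equimass_kernel k1 -> equimass_kernel k2 ->
    measurable_fun [set: T] (fun t => V (k1 t) (k2 t))) /\
  exists2 C, 0 <= C & forall alpha1 alpha2,
    finite_mean alpha1 -> finite_mean alpha2 ->
    `|V alpha1 alpha2| <= C * (absmean alpha1 + absmean alpha2).

Lemma integ_absmean alpha : finite_mean alpha -> integ alpha (fun x => `|x|).
Proof. by move=> [_ _ ia]; exact: integ_norm. Qed.

Lemma integ_linear_growth alpha g : finite_mean alpha ->
  linear_growth (fun x : measurableTypeR R => `|x|) g -> integ alpha g.
Proof.
move=> fa [mg [K gK]]; apply: le_integ gK => //; apply: integZ.
by apply: integD (integ_absmean fa); apply: integ_cst; case: fa.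
Qed.

Lemma integ_predictive alpha g : finite_mean alpha -> integ alpha g ->
  integ alpha (fun x => expect (add_point alpha x) g).
Proof.
move=> fa ga; have [ffa pa _] := fa.
rewrite (_ : (fun x => _) = (fun x =>
    (mass alpha + 1)^-1 * (mass alpha * expect alpha g + g x))).
  by apply: integZ; apply: integD => //; exact: integ_cst.
by apply/funext => x; rewrite expect_add_point// mulrC.
Qed.

Lemma absmean_add alpha beta : finite_mean alpha -> finite_mean beta ->
  absmean (addm alpha beta) <= absmean alpha + absmean beta.
Proof.
move=> fa fb; have [[_ pa _] [_ pb _]] := (fa, fb).
rewrite /absmean expect_add//; try exact: integ_absmean.
rewrite ler_pdivrMr ?addr_gt0//.
have := absmean_ge0 alpha; have := absmean_ge0 beta; rewrite /absmean.
nra.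
Qed.

Lemma tame_family_cst d (T : measurableType d) (w : T -> R) alpha :
  (forall t, 0 <= w t) -> finite_mean alpha -> tame_family w (fun=> alpha).
Proof.
move=> w0 fa; split => //; first by apply: kernel_cst; case: fa.
exists (absmean alpha) => t; rewrite mulrDr mulr1 lerDl mulr_ge0//.
exact: absmean_ge0.
Qed.

Lemma tame_family_add d (T : measurableType d) (w : T -> R) k1 k2 :
  tame_family w k1 -> tame_family w k2 -> tame_family w (fun t => addm (k1 t) (k2 t)).
Proof.
move=> [ek1 f1 [K1 b1]] [ek2 f2 [K2 b2]]; split.
- exact: kernel_add.
- by move=> t; exact: finite_mean_add.
- exists (K1 + K2) => t; apply: le_trans (absmean_add _ _) _ => //.
  by rewrite mulrDl lerD.
Qed.

Lemma tame_family_point d (T : measurableType d) (w : T -> R) (h : T -> R) :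
  measurable_fun [set: T] h -> (forall t, `|h t| <= w t) ->
  tame_family w (fun t => point (h t)).
Proof.
move=> mh hw; split.
- exact: kernel_dirac.
- by move=> t; exact: finite_mean_point.
- exists 1 => t; rewrite /absmean expect_point; first by rewrite mul1r ler_wpDl.
  exact: measurableT_comp.
Qed.

Lemma tame_family_scale d (T : measurableType d) (w : T -> R) (c : {nonneg R}) k :
  0 < c%:num -> tame_family w k -> tame_family w (fun t => mscale c (k t)).
Proof.
move=> c0 [ek fk [K bk]]; split.
- exact: kernel_scale.
- by move=> t; exact: finite_mean_scale.
- exists K => t; rewrite /absmean expect_scale//; first exact: bk.
  exact: integ_absmean.
Qed.

Lemma tame_value_linear_growth d (T : measurableType d) (w : T -> R) k1 k2 V :
  tame_value V -> tame_family w k1 -> tame_family w k2 ->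
  linear_growth w (fun t => V (k1 t) (k2 t)).
Proof.
move=> [mV [C C0 VC]] [ek1 f1 [K1 b1]] [ek2 f2 [K2 b2]]; split; first exact: mV.
exists (C * (K1 + K2)) => t; apply: le_trans (VC _ _ _ _) _ => //.
by rewrite -mulrA ler_wpM2l// mulrDl lerD.
Qed.

Lemma tame_value_swap V :
  tame_value V -> tame_value (fun alpha1 alpha2 => V alpha2 alpha1).
Proof.
move=> [mV [C C0 VC]]; split; first by move=> *; exact: mV.
by exists C => // a1 a2 f1 f2; rewrite addrC VC.
Qed.

Lemma measurable_select1 V a d (T : measurableType d)
    (k1 k2 : T -> borel_measure R) : tame_value V ->
  equimass_kernel k1 -> equimass_kernel k2 ->
  measurable_fun [set: T] (fun t => select1 V a (k1 t) (k2 t)).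
Proof.
move=> [mV _] ek1 ek2.
have mfst : measurable_fun setT (@fst T (measurableTypeR R)).
  exact: measurable_fst.
have msnd : measurable_fun setT (@snd T (measurableTypeR R)).
  exact: measurable_snd.
apply: measurable_funD.
  apply: measurable_funM; first exact: measurable_cst.
  exact: (@kernel_expect _ _ _ k1 (fun p => p.2)).
apply: (@kernel_expect _ _ _ k1
  (fun p => V (add_point (k1 p.1) p.2) (k2 p.1))) => //.
apply: mV; last exact: (kernel_comp mfst).
by apply: kernel_add_point => //; exact: (kernel_comp mfst).
Qed.

Lemma tame_value_select1 V a : tame_value V -> tame_value (select1 V a).
Proof.
move=> gV; split; first by move=> *; exact: measurable_select1.
have [mV [C C0 VC]] := gV.
exists (`|a| + C); first by rewrite addr_ge0.
move=> alpha1 alpha2 f1 f2; have [ff1 _ i1] := f1.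
have Iabs := integ_absmean f1.
have Ipred := integ_predictive f1 Iabs.
have Ibound : integ alpha1
    (fun x => C * (absmean (add_point alpha1 x) + absmean alpha2)).
  by apply: integZ; apply: integD => //; exact: integ_cst.
have VI : integ alpha1 (fun x => V (add_point alpha1 x) alpha2).
  apply: le_integ Ibound _; last first.
    by move=> x; apply: VC => //; exact: finite_mean_add_point.
  apply: mV; last by apply: kernel_cst; case: f2.
  by apply: kernel_add_point; [exact: kernel_cst|exact: measurable_id].
rewrite /select1 (le_trans (ler_normD _ _))// mulrDl lerD//.
  rewrite normrM ler_wpM2l// (le_trans (le_norm_expect i1))//.
  by rewrite lerDl absmean_ge0.
apply: le_trans (le_norm_expect VI) _.
apply: le_trans (le_expect (integ_norm VI) Ibound _) _.
  by move=> x; apply: VC => //; exact: finite_mean_add_point.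
rewrite expectZ//; last by apply: integD => //; exact: integ_cst.
by rewrite expectD//; [rewrite expect_predictive// expect_cst|exact: integ_cst].
Qed.

Lemma tame_value_select2 V a : tame_value V -> tame_value (select2 V a).
Proof. by move=> /tame_value_swap/(tame_value_select1 a)/tame_value_swap. Qed.

Lemma tame_value_max V V' : tame_value V -> tame_value V' ->
  tame_value (fun alpha1 alpha2 => Num.max (V alpha1 alpha2) (V' alpha1 alpha2)).
Proof.
move=> [mV [C C0 VC]] [mV' [C' C'0 V'C]]; split.
  by move=> *; apply: measurable_maxr; [exact: mV|exact: mV'].
exists (C + C') => [|a1 a2 f1 f2]; first by rewrite addr_ge0.
have := VC _ _ f1 f2; have := V'C _ _ f1 f2.
have := addr_ge0 (absmean_ge0 a1) (absmean_ge0 a2).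
rewrite mulrDl; set s := _ + _ => s0.
have := mulr_ge0 C0 s0; have := mulr_ge0 C'0 s0.
rewrite /Num.max; case: ifP => _; lra.
Qed.

Lemma tame_value_W A : tame_value (W A).
Proof.
elim: A => [|a A IH] /=.
  split; first by move=> *; exact: measurable_cst.
  by exists 0 => // *; rewrite normr0 mul0r.
by apply: tame_value_max; [exact: tame_value_select1|exact: tame_value_select2].
Qed.

End tame_families.

(** * Splitting and scaling the parameter of the first arm *)

Section splits.
Context {R : realType}.
Implicit Types (alpha beta gamma eta : borel_measure R) (g h : R -> R).
Implicit Types (V : borel_measure R -> borel_measure R -> R).

Lemma mass_ge0 eta : 0 <= mass eta.
Proof. exact: fine_ge0. Qed.

Definition lump eta (z : R) : borel_measure R :=
  mscale (NngNum (mass_ge0 eta)) (point z).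

Lemma lumpE eta z U : lump eta z U = ((mass eta)%:E * point z U)%E.
Proof. by []. Qed.

Lemma finite_mean_lump eta z : finite_mean eta -> finite_mean (lump eta z).
Proof.
move=> [_ pe _]; apply: finite_mean_scale => //; exact: finite_mean_point.
Qed.

Lemma mass_lump eta z : mass (lump eta z) = mass eta.
Proof.
by rewrite mass_scale/= ?mass_point ?mulr1// [X in (X < _)%E]diracT ltry.
Qed.

Lemma expect_lump eta z g : finite_mean eta -> measurable_fun [set: R] g ->
  expect (lump eta z) g = g z.
Proof.
move=> [_ pe _] mg; rewrite expect_scale//; first exact: expect_point.
  exact: finite_mean_point.
exact: integ_dirac.
Qed.

Lemma integ_lump eta z g : measurable_fun [set: R] g -> integ (lump eta z) g.
Proof. by move=> mg; apply: integ_mscale; exact: integ_dirac. Qed.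

Lemma tame_family_lump eta d (T : measurableType d) (w : T -> R) (h : T -> R) :
  finite_mean eta ->
  measurable_fun [set: T] h -> (forall t, `|h t| <= w t) ->
  tame_family w (fun t => lump eta (h t)).
Proof.
move=> [_ pe _] mh hw; apply: tame_family_scale => //.
exact: tame_family_point.
Qed.

Lemma tame_family_add_point d (T : measurableType d) (w : T -> R) k
    (h : T -> R) :
  tame_family w k -> measurable_fun [set: T] h -> (forall t, `|h t| <= w t) ->
  tame_family w (fun t => add_point (k t) (h t)).
Proof.
by move=> tk mh hw; apply: tame_family_add => //; exact: tame_family_point.
Qed.

Lemma add_pointDl alpha beta x :
  addm (add_point alpha x) beta = add_point (addm alpha beta) x.
Proof.
apply: measure_ext => U; rewrite !addmE.
by rewrite -!addeA; congr (_ + _)%E; exact: addeC.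
Qed.

Lemma add_pointDr alpha beta x :
  addm alpha (add_point beta x) = add_point (addm alpha beta) x.
Proof. by apply: measure_ext => U; rewrite !addmE addeA. Qed.

(** This is where the two masses agree in the splitting argument: observing
    the position of the atom makes it as heavy as the part of the parameter
    that has received one observation. *)
Lemma lump_add_point eta x z : finite_mean eta ->
  lump (add_point eta x) z = add_point (lump eta z) z.
Proof.
move=> [fe pe _]; apply: measure_ext => U; rewrite addmE !lumpE.
rewrite mass_add// ?mass_point; last by rewrite [X in (X < _)%E]diracT ltry.
by rewrite EFinD ge0_muleDl ?mul1e// lee_fin mass_ge0.
Qed.

(** A form of Jensen inequality: [gamma + eta] is the mean of the random measure
    [gamma + lump eta Z]. *)
Definition split_convex V : Prop := forall gamma eta alpha2,
  finite_mean gamma -> finite_mean eta -> finite_mean alpha2 ->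
  V (addm gamma eta) alpha2 <=
    expect eta (fun z => V (addm gamma (lump eta z)) alpha2).

Definition gauge1 (x : measurableTypeR R) : R := `|x|.
Definition gauge2 (p : measurableTypeR R * measurableTypeR R) : R :=
  `|p.1| + `|p.2|.

Lemma gauge1_ge0 x : 0 <= gauge1 x. Proof. exact: normr_ge0. Qed.
Lemma gauge2_ge0 p : 0 <= gauge2 p. Proof. exact: addr_ge0. Qed.
Lemma gauge2_fst p : `|p.1| <= gauge2 p. Proof. by rewrite lerDl. Qed.
Lemma gauge2_snd p : `|p.2| <= gauge2 p. Proof. by rewrite lerDr. Qed.
Hint Resolve gauge1_ge0 gauge2_ge0 gauge2_fst gauge2_snd : core.

Lemma integ_tame_value V k1 k2 alpha :
  tame_value V -> tame_family gauge1 k1 -> tame_family gauge1 k2 ->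
  finite_mean alpha -> integ alpha (fun x => V (k1 x) (k2 x)).
Proof.
move=> gV t1 t2 fa; apply: integ_linear_growth fa _.
exact: tame_value_linear_growth gV t1 t2.
Qed.

Lemma expect_swap_tame_value V k1 k2 alpha beta :
  tame_value V -> tame_family gauge2 k1 -> tame_family gauge2 k2 ->
  finite_mean alpha -> finite_mean beta ->
  integ alpha (fun x => expect beta (fun y => V (k1 (x, y)) (k2 (x, y)))) /\
  expect alpha (fun x => expect beta (fun y => V (k1 (x, y)) (k2 (x, y)))) =
  expect beta (fun y => expect alpha (fun x => V (k1 (x, y)) (k2 (x, y)))).
Proof.
move=> gV t1 t2 fa fb.
have [mf [K fK]] := tame_value_linear_growth gV t1 t2.
have [ffa _ _] := fa; have [ffb _ _] := fb.
have Ia := integ_absmean fa; have Ib := integ_absmean fb.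
have ga : integ alpha (fun x => K * (1 + `|x|)).
  by apply: integZ; apply: integD => //; exact: integ_cst.
have gb : integ beta (fun y => K * `|y|) by exact: integZ.
have fab x y : `|V (k1 (x, y)) (k2 (x, y))| <= K * (1 + `|x|) + K * `|y|.
  by rewrite -mulrDr -addrA; exact: (fK (x, y)).
exact: (@expect_swap _ _ _ (fun p => V (k1 p) (k2 p)) _ _ fa fb mf ga gb fab).
Qed.

(** The next observation comes from [gamma] or from [eta]. Both cases use the
    hypothesis on [V], the first with the observation added to [gamma], the
    second with the observation added to [eta]. *)
Lemma split_convex_select1 V a : tame_value V -> split_convex V ->
  split_convex (select1 V a).
Proof.
move=> gV sV gamma eta alpha2 fg fe f2.
have [ffg pg ig] := fg; have [ffe pe ie] := fe.
set d := mass eta; set m := mass gamma.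
have tc1 alpha : finite_mean alpha -> tame_family gauge1 (fun=> alpha).
  exact: tame_family_cst.
have tc2 alpha : finite_mean alpha -> tame_family gauge2 (fun=> alpha).
  exact: tame_family_cst.
have tl1 : tame_family gauge1 (fun z => addm gamma (lump eta z)).
  by apply: tame_family_add; [exact: tc1|exact: tame_family_lump].
have fl z : finite_mean (addm gamma (lump eta z)).
  by apply: finite_mean_add => //; exact: finite_mean_lump.
have fge : finite_mean (addm gamma eta) by exact: finite_mean_add.
pose v x := V (add_point (addm gamma eta) x) alpha2.
pose u x z := V (add_point (addm gamma (lump eta z)) x) alpha2.
have vI alpha : finite_mean alpha -> integ alpha v.
  move=> fa; apply: integ_tame_value => //; last exact: tc1.
  by apply: tame_family_add_point => //; exact: tc1.
have uI z alpha : finite_mean alpha -> integ alpha (u ^~ z).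
  move=> fa; apply: (@integ_tame_value _
    (fun x => add_point (addm gamma (lump eta z)) x)) => //; last exact: tc1.
  by apply: tame_family_add_point => //; exact: tc1.
have udI alpha : finite_mean alpha -> integ alpha (fun z => u z z).
  move=> fa; apply: (@integ_tame_value _
    (fun z => add_point (addm gamma (lump eta z)) z)) => //; last exact: tc1.
  exact: tame_family_add_point.
have uE z : expect (addm gamma (lump eta z)) (u ^~ z) =
    (m * expect gamma (u ^~ z) + d * u z z) / (m + d).
  have mu := integ_measurable (uI z _ fg).
  rewrite expect_add ?mass_lump ?expect_lump//; [exact: finite_mean_lump| |].
    exact: uI.
  exact: integ_lump.
have [swapI swapE] : integ eta (fun z => expect gamma (u ^~ z)) /\
    expect eta (fun z => expect gamma (u ^~ z)) =
    expect gamma (fun x => expect eta (u x)).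
  apply: (@expect_swap_tame_value _
    (fun p => add_point (addm gamma (lump eta p.1)) p.2) (fun=> alpha2)) => //;
    last exact: tc2.
  apply: tame_family_add_point => //; apply: tame_family_add; first exact: tc2.
  exact: tame_family_lump.
have [swapI' _] : integ gamma (fun x => expect eta (u x)) /\
    expect gamma (fun x => expect eta (u x)) =
    expect eta (fun z => expect gamma (u ^~ z)).
  apply: (@expect_swap_tame_value _
    (fun p => add_point (addm gamma (lump eta p.2)) p.1) (fun=> alpha2)) => //;
    last exact: tc2.
  apply: tame_family_add_point => //; apply: tame_family_add; first exact: tc2.
  exact: tame_family_lump.
have gam_part : expect gamma v <= expect eta (fun z => expect gamma (u ^~ z)).
  rewrite swapE; apply: le_expect => [||x] //; first exact: vI.
  rewrite /v -add_pointDl.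
  rewrite (_ : u x = fun z => V (addm (add_point gamma x) (lump eta z)) alpha2).
    by apply: sV => //; exact: finite_mean_add_point.
  by apply/funext => z; rewrite add_pointDl.
(* for an observation [x] from [eta] the atom is drawn from [add_point eta x],
   and averaging over [x] gives back a draw from [eta] *)
have eta_part : expect eta v <= expect eta (fun z => u z z).
  rewrite -[leRHS]expect_predictive//; last exact: udI.
  apply: le_expect => [||x]; first exact: vI.
    by apply: integ_predictive => //; exact: udI.
  rewrite /v -add_pointDr.
  rewrite (_ : (fun z => u z z) =
      fun z => V (addm gamma (lump (add_point eta x) z)) alpha2).
    by apply: sV => //; exact: finite_mean_add_point.
  by apply/funext => z; rewrite lump_add_point// add_pointDr.
have md : 0 < m + d by rewrite addr_gt0.
rewrite /select1 -/v (_ : (fun z => _) = (fun z => (m + d)^-1 *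
   (a * (m * mean gamma) + (a * d * z +
     (m * expect gamma (u ^~ z) + d * u z z))))); last first.
  apply/funext => z; rewrite -/(u ^~ z) uE.
  rewrite /mean expect_add// ?mass_lump ?expect_lump//; last 2 first.
  - exact: finite_mean_lump.
  - exact: integ_lump.
  by rewrite -/m -/d; field; rewrite gt_eqF.
have I1 : integ eta (fun z => m * expect gamma (u ^~ z) + d * u z z).
  by apply: integD; apply: integZ => //; exact: udI.
have I2 : integ eta (fun z => a * d * z + (m * expect gamma (u ^~ z) + d * u z z)).
  by apply: integD => //; exact: integZ.
rewrite expectZ; last by apply: integD => //; exact: integ_cst.
rewrite expectD//; last exact: integ_cst.
rewrite expectD//; last exact: integZ.
rewrite expectD; [|exact: integZ|by apply: integZ; exact: udI].
rewrite expect_cst// (expectZ _ ie) (expectZ _ swapI) (expectZ _ (udI _ fe)).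
rewrite expect_add//; [|exact: vI|exact: vI].
rewrite /mean expect_add// -/m -/d.
rewrite [leLHS](_ : _ = (m + d)^-1 * (a * (m * mean gamma) +
  (a * d * mean eta + (m * expect gamma v + d * expect eta v)))); last first.
  by rewrite /mean; field; rewrite gt_eqF.
rewrite ler_wpM2l ?invr_ge0 ?(ltW md)//.
apply: lerD; first exact: lexx.
by rewrite lerD2l lerD// ler_wpM2l ?(ltW pe) ?(ltW pg).
Qed.

Lemma split_convex_select2 V a : tame_value V -> split_convex V ->
  split_convex (select2 V a).
Proof.
move=> gV sV gamma eta alpha2 fg fe f2; have [ff2 _ _] := f2.
have tc2 alpha : finite_mean alpha -> tame_family gauge2 (fun=> alpha).
  exact: tame_family_cst.
pose u z y := V (addm gamma (lump eta z)) (add_point alpha2 y).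
have [Iz zE] : integ eta (fun z => expect alpha2 (u z)) /\
    expect eta (fun z => expect alpha2 (u z)) =
    expect alpha2 (fun y => expect eta (u ^~ y)).
  apply: (@expect_swap_tame_value _ (fun p => addm gamma (lump eta p.1))
    (fun p => add_point alpha2 p.2)) => //.
    by apply: tame_family_add; [exact: tc2|exact: tame_family_lump].
  by apply: tame_family_add_point => //; exact: tc2.
have [Iy _] : integ alpha2 (fun y => expect eta (u ^~ y)) /\
    expect alpha2 (fun y => expect eta (u ^~ y)) =
    expect eta (fun z => expect alpha2 (u z)).
  apply: (@expect_swap_tame_value _ (fun p => addm gamma (lump eta p.2))
    (fun p => add_point alpha2 p.1)) => //.
    by apply: tame_family_add; [exact: tc2|exact: tame_family_lump].
  by apply: tame_family_add_point => //; exact: tc2.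
rewrite /select2 expectD//; last by apply: integ_cst; case: fe.
rewrite expect_cst// lerD2l zE; apply: le_expect => // [|y].
  apply: integ_tame_value => //.
    by apply: tame_family_cst => //; exact: finite_mean_add.
  by apply: tame_family_add_point => //; exact: tame_family_cst.
by apply: sV => //; exact: finite_mean_add_point.
Qed.

Lemma split_convex_W A : split_convex (W A).
Proof.
elim: A => [|a A IH] gamma eta alpha2 fg fe f2; first by rewrite /= expect_cst.
have tg : tame_family gauge1 (fun z => addm gamma (lump eta z)).
  apply: tame_family_add; first exact: tame_family_cst.
  by apply: tame_family_lump => //; exact: measurable_id.
have t2 : tame_family gauge1 (fun=> alpha2) by exact: tame_family_cst.
have gW := tame_value_W A.
have I1 := integ_tame_value (tame_value_select1 a gW) tg t2 fe.
have I2 := integ_tame_value (tame_value_select2 a gW) tg t2 fe.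
have I := integ_tame_value (tame_value_W (a :: A)) tg t2 fe.
rewrite /= ge_max; apply/andP; split.
  apply: le_trans (split_convex_select1 a gW IH fg fe f2) _.
  by apply: le_expect => // z; rewrite /= le_max lexx.
apply: le_trans (split_convex_select2 a gW IH fg fe f2) _.
by apply: le_expect => // z; rewrite /= le_max lexx orbT.
Qed.

Definition scaling_decreasing V : Prop :=
  forall (k : {nonneg R}) alpha1 alpha2, 1 < k%:num ->
  finite_mean alpha1 -> finite_mean alpha2 ->
  V (mscale k alpha1) alpha2 <= V alpha1 alpha2.

(** The posterior of the heavier arm is a multiple [l > 1] of a measure
    [alpha + eta x] of the mass of the lighter posterior, where [eta x] only
    keeps a proportion [t] of the observation and replaces the rest by mass
    spread as in [alpha]. *)
Lemma scaling_decreasing_select1 V a : tame_value V -> split_convex V ->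
  scaling_decreasing V -> scaling_decreasing (select1 V a).
Proof.
move=> gV sV dV k alpha beta k1 fa fb.
have k0 : 0 < k%:num by exact: lt_trans k1.
have [ffa m0 ia] := fa; set m := mass alpha in m0.
(* [t], [l] and [c] below solve [l * t = 1], [l * (1 + c) = k] and
   [c * m + t = 1]; the last equation says that [eta x] has mass one *)
have t0 : 0 < (m + 1) / (k%:num * m + 1) by rewrite divr_gt0 ?addr_gt0 ?mulr_gt0.
have l1 : 1 < (k%:num * m + 1) / (m + 1).
  rewrite ltr_pdivlMr ?addr_gt0// mul1r ltrD2r; nra.
have c0 : 0 < (k%:num - 1) / (k%:num * m + 1).
  by rewrite divr_gt0 ?subr_gt0 ?addr_gt0 ?mulr_gt0.
pose t := NngNum (ltW t0); pose l := NngNum (ltW (lt_trans ltr01 l1)).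
pose c := NngNum (ltW c0).
have ? : 0 < k%:num * m + 1 by rewrite addr_gt0 ?mulr_gt0.
have ? : 0 < m + 1 by rewrite addr_gt0.
pose eta x := addm (mscale c alpha) (mscale t (point x)).
have fcx x : finite_mean (mscale t (point x)).
  by apply: finite_mean_scale => //; exact: finite_mean_point.
have fca : finite_mean (mscale c alpha) by exact: finite_mean_scale.
have feta x : finite_mean (eta x) by exact: finite_mean_add.
have mca : mass (mscale c alpha) = c%:num * m by rewrite mass_scale.
have mtx x : mass (mscale t (point x)) = t%:num.
  by rewrite mass_scale ?mass_point ?mulr1// [X in (X < _)%E]diracT ltry.
have cmt : c%:num * m + t%:num = 1 by rewrite /=; field; rewrite gt_eqF.
have meta x : mass (eta x) = 1.
  by rewrite mass_add ?mca ?mtx//; [case: fca|case: (fcx x)].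
have scaleE x : add_point (mscale k alpha) x = mscale l (addm alpha (eta x)).
  have lt1 : l%:num * t%:num = 1.
    by rewrite /=; field; rewrite !gt_eqF.
  have lc : l%:num * (1 + c%:num) = k%:num.
    by rewrite /=; field; rewrite !gt_eqF.
  apply: measure_ext => U; rewrite addmE.
  change (k%:num%:E * alpha U + point x U = l%:num%:E * addm alpha (eta x) U)%E.
  rewrite !addmE.
  change (k%:num%:E * alpha U + point x U = l%:num%:E *
    (alpha U + (c%:num%:E * alpha U + t%:num%:E * point x U)))%E.
  have aE : (alpha U + c%:num%:E * alpha U = (1 + c%:num)%:E * alpha U)%E.
    by rewrite EFinD ge0_muleDl ?mul1e// lee_fin.
  rewrite addeA aE ge0_muleDr ?mule_ge0 ?lee_fin ?addr_ge0//.
  by rewrite !muleA -!EFinM lc lt1 mul1r.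
have lumpE x z : addm alpha (lump (eta x) z) = add_point alpha z.
  by apply: measure_ext => U; rewrite !addmE lumpE meta mul1e.
pose v x := V (add_point alpha x) beta.
have vI : integ alpha v.
  apply: integ_tame_value => //; last exact: tame_family_cst.
  by apply: tame_family_add_point => //; exact: tame_family_cst.
have vm := integ_measurable vI.
have step x : V (add_point (mscale k alpha) x) beta <=
    c%:num * m * expect alpha v + t%:num * v x.
  rewrite scaleE; apply: le_trans (dV l _ _ l1 _ fb) _.
    exact: finite_mean_add.
  apply: le_trans (sV _ _ _ fa (feta x) fb) _.
  rewrite (_ : (fun z => _) = v); last by apply/funext => z; rewrite lumpE.
  have vx : integ (mscale t (point x)) v.
    by apply: integ_mscale; exact: integ_dirac.
  rewrite expect_add//; last exact: integ_mscale.
  rewrite !expect_scale// ?expect_point//; last 2 first.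
  - exact: finite_mean_point.
  - exact: integ_dirac.
  by rewrite mca mtx cmt divr1.
rewrite /select1 /mean !expect_scale//; last 1 first.
- apply: integ_tame_value => //; last exact: tame_family_cst.
  apply: tame_family_add_point => //; apply: tame_family_cst => //.
  exact: finite_mean_scale.
rewrite lerD2l.
have bI : integ alpha (fun x => c%:num * m * expect alpha v + t%:num * v x).
  by apply: integD; [exact: integ_cst|exact: integZ].
apply: le_trans (le_expect _ bI step) _.
  apply: integ_tame_value => //; last exact: tame_family_cst.
  apply: tame_family_add_point => //; apply: tame_family_cst => //.
  exact: finite_mean_scale.
rewrite expectD; [|exact: integ_cst|exact: integZ].
by rewrite expect_cst// expectZ// -mulrDl cmt mul1r.
Qed.

Lemma scaling_decreasing_select2 V a : tame_value V ->
  scaling_decreasing V -> scaling_decreasing (select2 V a).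
Proof.
move=> gV dV k alpha beta k1 fa fb; rewrite /select2 lerD2l.
have fka : finite_mean (mscale k alpha).
  by apply: finite_mean_scale => //; exact: lt_trans k1.
apply: le_expect => [||y].
- apply: integ_tame_value => //; first exact: tame_family_cst.
  by apply: tame_family_add_point => //; exact: tame_family_cst.
- apply: integ_tame_value => //; first exact: tame_family_cst.
  by apply: tame_family_add_point => //; exact: tame_family_cst.
- by apply: dV => //; exact: finite_mean_add_point.
Qed.

Lemma scaling_decreasing_W A : scaling_decreasing (W A).
Proof.
elim: A => [|a A IH] k alpha beta k1 fa fb //=.
have gW := tame_value_W A; have sW := split_convex_W A.
have := scaling_decreasing_select1 a gW sW IH k1 fa fb.
have := scaling_decreasing_select2 a gW IH k1 fa fb.
by move=> W2 W1; rewrite ge_max !le_max W1 W2 orbT.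
Qed.

End splits.

(** * Regular discount sequences and optimal stopping *)

Section discount.
Context {R : realType}.
Implicit Types (A B : seq R).

Definition nonneg_seq A : Prop := forall i, (i < size A)%N -> 0 <= A`_i.

Lemma tail_sum_ge0 A j : nonneg_seq A -> 0 <= tail_sum A j.
Proof.
by move=> A0; rewrite /tail_sum big_nat sumr_ge0// => i /andP[_]; exact: A0.
Qed.

Lemma tail_sum_consS (a : R) A j : tail_sum (a :: A) j.+1 = tail_sum A j.
Proof. by rewrite /tail_sum /= big_add1. Qed.

Lemma tail_sum_cons0 (a : R) A : tail_sum (a :: A) 0 = a + tail_sum A 0.
Proof. by rewrite /tail_sum /= big_ltn// big_add1. Qed.

Lemma tail_sum_nil j : tail_sum ([::] : seq R) j = 0.
Proof. by rewrite /tail_sum big_geq. Qed.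

Lemma tail_sum_le A j : nonneg_seq A -> tail_sum A j.+1 <= tail_sum A j.
Proof.
move=> A0; have [jA|Aj] := ltnP j (size A).
  by rewrite [leRHS]/tail_sum big_ltn// lerDr A0.
by rewrite /tail_sum !big_geq// (leq_trans Aj).
Qed.

(** Regularity says that consecutive ratios of tails decrease, so each of them is
    at most the first one. *)
Lemma regular_tail_ratio A j : nonneg_seq A -> regular A ->
  tail_sum A j.+1 * tail_sum A 0 <= tail_sum A 1 * tail_sum A j.
Proof.
move=> A0 rA; elim: j => [|j IH]; first by rewrite mulrC.
have T0 i := tail_sum_ge0 i A0.
have [Tj|Tj] := eqVneq (tail_sum A j.+1) 0.
  have Tj2 : tail_sum A j.+2 = 0.
    by apply/le_anti; rewrite T0 andbT -[leRHS]Tj tail_sum_le.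
  by rewrite Tj2 Tj mul0r mulr0.
have Tj1 : 0 < tail_sum A j.+1 by rewrite lt_neqAle eq_sym Tj T0.
have Tj0 : 0 < tail_sum A j by apply: lt_le_trans Tj1 _; exact: tail_sum_le.
rewrite -(ler_pM2l Tj0) mulrA.
apply: le_trans (ler_wpM2r (T0 0%N) (rA j)) _.
rewrite expr2 -mulrA; apply: le_trans (ler_wpM2l (T0 _) IH) _.
lra.
Qed.

End discount.

Section stopping.
Context {R : realType}.
Implicit Types (alpha beta : borel_measure R) (A B : seq R).

(** Optimal gain over pulling arm 1 at all stages: the value of the problem of
    stopping arm 1 and collecting, for all the remaining stages, the difference
    of the two current means. *)
Fixpoint excess A alpha beta : R :=
  if A is _ :: A' then
    Num.max (tail_sum A 0 * (mean beta - mean alpha))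
      (expect alpha (fun x => excess A' (add_point alpha x) beta))
  else 0.

(** The recursive term of [excess] is the payoff of arm 1 at a stage with zero
    discount. *)
Lemma tame_value_excess A : tame_value (excess A).
Proof.
elim: A => [|a A IH].
  split; first by move=> *; exact: measurable_cst.
  by exists 0 => // *; rewrite normr0 mul0r.
apply: (@tame_value_max _
  (fun alpha beta => tail_sum (a :: A) 0 * (mean beta - mean alpha))
  (fun alpha beta => expect alpha (fun x => excess A (add_point alpha x) beta))).
  set T := tail_sum _ _; split.
    move=> d S k1 k2 ek1 ek2.
    have msnd : measurable_fun setT (@snd S (measurableTypeR R)).
      exact: measurable_snd.
    apply: measurable_funM; first exact: measurable_cst.
    by apply: measurable_funB; exact: (@kernel_expect _ _ _ _ (fun p => p.2)).
  exists `|T| => // a1 a2 [_ _ i1] [_ _ i2].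
  rewrite normrM ler_wpM2l// [leRHS]addrC (le_trans (ler_normB _ _))// lerD//.
    exact: le_norm_expect.
  exact: le_norm_expect.
have := tame_value_select1 0 IH; congr tame_value.
by apply/funext => a1; apply/funext => a2; rewrite /select1 mul0r add0r.
Qed.

Lemma integ_excess A alpha beta : finite_mean alpha -> finite_mean beta ->
  integ alpha (fun x => excess A (add_point alpha x) beta).
Proof.
move=> fa fb; apply: (integ_tame_value (tame_value_excess A)) => //.
  by apply: tame_family_add_point => //; exact: (tame_family_cst gauge1_ge0).
exact: (tame_family_cst gauge1_ge0).
Qed.

Lemma excess_ge0 A alpha beta : finite_mean alpha -> finite_mean beta ->
  0 <= excess A alpha beta.
Proof.
elim: A alpha => [|a A IH] alpha fa fb //=.
rewrite le_max; apply/orP; right; rewrite -(expect_cst 0 fa).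
apply: le_expect; [by apply: integ_cst; case: fa|exact: integ_excess|].
by move=> x; apply: IH => //; exact: finite_mean_add_point.
Qed.

(** Where stopping yields a gain, the tails of [B] make it at most [c] times as
    large as those of [A] do; where it yields a loss, going on to the end, which
    yields zero, is better. *)
Lemma excess_le A B (c : R) alpha beta :
  finite_mean alpha -> finite_mean beta ->
  0 <= c -> (size B <= size A)%N ->
  (forall j, 0 <= tail_sum B j <= c * tail_sum A j) ->
  excess B alpha beta <= c * excess A alpha beta.
Proof.
move=> + fb c0; elim: A B alpha => [|a A IH] [|b B] alpha fa // sBA BA.
- by rewrite mulr0.
- by rewrite /= mulr_ge0// (@excess_ge0 (a :: A)).
rewrite ge_max; apply/andP; split.
  have /andP[B0 BcA] := BA 0%N.
  have [le0|ge0] := leP (mean beta - mean alpha) 0.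
    apply: (@le_trans _ _ 0); first exact: mulr_ge0_le0.
    by rewrite mulr_ge0// (@excess_ge0 (a :: A)).
  apply: (@le_trans _ _ (c * (tail_sum (a :: A) 0 * (mean beta - mean alpha)))).
    by rewrite mulrA ler_wpM2r// ltW.
  by rewrite ler_wpM2l// le_max lexx.
apply: (@le_trans _ _
    (c * expect alpha (fun x => excess A (add_point alpha x) beta))).
  rewrite -expectZ; last exact: integ_excess.
  apply: le_expect; [exact: integ_excess|by apply: integZ; exact: integ_excess|].
  move=> x; apply: IH => //; first exact: finite_mean_add_point.
  by move=> j; have := BA j.+1; rewrite !tail_sum_consS.
by rewrite ler_wpM2l// le_max lexx orbT.
Qed.

(** The measures [k delta_lam] that the parameter of the known arm runs through,
    described by the way they integrate. *)
Definition known (lam : R) beta : Prop :=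
  finite_mean beta /\ forall g, measurable_fun [set: R] g ->
    integ beta g /\ expect beta g = g lam.

Lemma known_point lam : known lam (point lam).
Proof.
split; first exact: finite_mean_point.
by move=> g mg; split; [exact: integ_dirac|exact: expect_point].
Qed.

Lemma known_add_point lam beta :
  known lam beta -> known lam (add_point beta lam).
Proof.
move=> [fb kb]; have [_ pb _] := fb.
split; first exact: finite_mean_add_point.
move=> g mg; have [gb gE] := kb _ mg; split.
  by apply: integ_addm => //; exact: integ_dirac.
rewrite expect_add_point// gE; field.
by rewrite gt_eqF// addr_gt0.
Qed.

Lemma mean_known lam beta : known lam beta -> mean beta = lam.
Proof. by move=> [_ /(_ id)[]]; first exact: measurable_id. Qed.

Lemma select2_known V a lam alpha beta : tame_value V ->
  finite_mean alpha -> known lam beta ->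
  select2 V a alpha beta = a * lam + V alpha (add_point beta lam).
Proof.
move=> [mV _] [fa _ _] kb; rewrite /select2 (mean_known kb); congr (_ + _).
have [[fb _ _] kE] := kb.
have [|_ ->//] := kE (fun y => V alpha (add_point beta y)).
apply: (mV _ (measurableTypeR R)); first exact: kernel_cst.
by apply: kernel_add_point; [exact: kernel_cst|exact: measurable_id].
Qed.

Lemma excess_ge A alpha beta : finite_mean alpha -> finite_mean beta ->
  tail_sum A 0 * (mean beta - mean alpha) <= excess A alpha beta.
Proof.
by case: A => [|a A] fa fb; rewrite ?tail_sum_nil ?mul0r//= le_max lexx.
Qed.

(** Delaying the stopping problem by one stage is not profitable. With [c] the
    ratio of the first two tails, the delayed problem is worth at most [c] times
    the original one by [excess_le], and [a = (1 - c)] times the first tail, so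
    the left-hand side is at most a convex combination of stopping at once and
    of stopping optimally. *)
Lemma excess_tail a A alpha beta :
  finite_mean alpha -> finite_mean beta ->
  nonneg_seq (a :: A) -> regular (a :: A) ->
  a * (mean beta - mean alpha) + excess A alpha beta <=
  excess (a :: A) alpha beta.
Proof.
move=> fa fb pA rA.
have T0 j := tail_sum_ge0 j pA.
set T := tail_sum (a :: A) 0; set T1 := tail_sum A 0.
have TE : T = a + T1 := tail_sum_cons0 a A.
have T1T : T1 <= T by rewrite /T1 -(tail_sum_consS a); exact: tail_sum_le.
have T10 : 0 <= T1 by rewrite /T1 -(tail_sum_consS a).
have c0 : 0 <= T1 / T by rewrite divr_ge0// T0.
have ratio : excess A alpha beta <= T1 / T * excess (a :: A) alpha beta.
  apply: excess_le => //= j; rewrite -(tail_sum_consS a) T0/=.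
  have := regular_tail_ratio j pA rA; rewrite -/T !tail_sum_consS -/T1.
  have [T00 _|Tn0] := eqVneq T 0.
    rewrite T00 invr0 mulr0 mul0r -(tail_sum_consS a).
    elim: j => [|j Tj]; apply: le_trans (tail_sum_le _ pA) _ => //.
    by rewrite -/T T00.
  by rewrite mulrAC ler_pdivlMr// lt_neqAle eq_sym Tn0 T0.
have X := excess_ge (a :: A) fa fb; rewrite -/T in X.
have [T00|Tn0] := eqVneq T 0.
  have a0 : a = 0.
    by have := pA 0%N isT; rewrite /=; move: TE T10; rewrite T00; lra.
  rewrite a0 mul0r add0r (le_trans ratio)// T00 invr0 mulr0 mul0r.
  exact: excess_ge0.
have Tp : 0 < T by rewrite lt_neqAle eq_sym Tn0 T0.
have c1 : T1 / T <= 1 by rewrite ler_pdivrMr// mul1r.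
have aE : a = (1 - T1 / T) * T by rewrite mulrBl mul1r divfK// TE addrK.
rewrite [in leLHS]aE -mulrA.
have : (1 - T1 / T) * (T * (mean beta - mean alpha)) <=
    (1 - T1 / T) * excess (a :: A) alpha beta.
  by rewrite ler_wpM2l// subr_ge0.
move: ratio; set c := T1 / T; set E := excess (a :: A) _ _; lra.
Qed.

Lemma nonneg_tail a A : nonneg_seq (a :: A) -> nonneg_seq A.
Proof. by move=> pA i iA; exact: (pA i.+1). Qed.

Lemma regular_tail a A : regular (a :: A) -> regular A.
Proof. by move=> rA j; have := rA j.+1; rewrite !tail_sum_consS. Qed.

(** By [excess_tail], pulling the known arm and then returning to arm 1 is never
    better than the better of stopping at once and pulling arm 1. The second
    equation has the form of the first one without the option to stop at once. *)
Lemma W_excess A lam alpha beta : nonneg_seq A -> regular A ->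
  finite_mean alpha -> known lam beta ->
  W A alpha beta = tail_sum A 0 * mean alpha + excess A alpha (point lam) /\
  W1 A alpha beta = tail_sum A 0 * mean alpha +
    (if A is _ :: A' then
       expect alpha (fun x => excess A' (add_point alpha x) (point lam))
     else 0).
Proof.
elim: A alpha beta => [|a A IH] alpha beta pA rA fa kb.
  by rewrite /= tail_sum_nil mul0r addr0.
have {}IH := IH _ _ (nonneg_tail pA) (regular_tail rA).
have fl := finite_mean_point lam.
have [ffa _ ia] := fa.
have W1E : select1 (W A) a alpha beta = tail_sum (a :: A) 0 * mean alpha +
    expect alpha (fun x => excess A (add_point alpha x) (point lam)).
  rewrite /select1 (_ : (fun x => _) = (fun x =>
      tail_sum A 0 * mean (add_point alpha x) +
      excess A (add_point alpha x) (point lam))); last first.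
    by apply/funext => x; have [->] := IH _ _ (finite_mean_add_point x fa) kb.
  have pI : integ alpha (fun x => mean (add_point alpha x)).
    exact: integ_predictive.
  rewrite expectD; [|exact: integZ|exact: integ_excess].
  by rewrite expectZ// expect_predictive// tail_sum_cons0 mulrDl addrA.
split; last exact: W1E.
rewrite [W _ _ _]/= W1E (select2_known _ (tame_value_W A) fa kb).
have [-> _] := IH _ _ fa (known_add_point kb).
have mE := mean_known (known_point lam).
have := excess_tail fa fl pA rA; have := excess_ge A fa fl.
rewrite /= mE tail_sum_cons0.
set E := expect _ _; set X := excess A _ _; set mu := mean alpha.
set T := tail_sum A 0.
rewrite /Num.max; case: ifP; case: ifP => h1 h2 h3 h4; lra.
Qed.

End stopping.

Section break_even.
Context {R : realType}.
Implicit Types (alpha beta : borel_measure R) (A B : seq R).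

Lemma not_arm1_optimal_W A lam alpha beta : nonneg_seq A -> regular A ->
  finite_mean alpha -> known lam beta ->
  ~ arm1_optimal A alpha beta -> W A alpha beta = tail_sum A 0 * lam.
Proof.
move=> pA rA fa kb; rewrite /arm1_optimal.
have [-> ->] := W_excess pA rA fa kb.
case: A pA rA => [|a A] pA rA //=.
rewrite (mean_known (known_point lam)) /Num.max; case: ifP => // _ _.
by rewrite -mulrDr addrC subrK.
Qed.

Lemma W2_ge A lam alpha beta : nonneg_seq A -> regular A ->
  finite_mean alpha -> known lam beta -> tail_sum A 0 * lam <= W2 A alpha beta.
Proof.
case: A => [|a A] pA rA fa kb; first by rewrite tail_sum_nil mul0r.
rewrite /W2 (select2_known _ (tame_value_W A) fa kb).
have [-> _] := W_excess (nonneg_tail pA) (regular_tail rA) fa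
  (known_add_point kb).
have := excess_ge A fa (finite_mean_point lam).
by rewrite (mean_known (known_point lam)) tail_sum_cons0; lra.
Qed.

Lemma W2_le_W A alpha beta : W2 A alpha beta <= W A alpha beta.
Proof. by case: A => [|a A] //=; rewrite le_max lexx orbT. Qed.

End break_even.

Theorem corollary2 (R : realType) (n : nat) (A : n.-tuple R)
    (F : probability (measurableTypeR R) R) (M M' : {nonneg R})
    (L L' : R) :
  (1 <= n)%N ->
  discount_sequence A ->
  regular A ->
  F.-integrable [set: R] (fun x : R => x%:E) ->
  0 < M%:num -> M%:num < M'%:num ->
  is_break_even (mscale M F) A L ->
  is_break_even (mscale M' F) A L' ->
  L >= L'.
Proof.
move=> _ [pA _] rA iF M0 MM' bL bL'; rewrite leNgt; apply/negP => LL'.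
pose lam := (L + L') / 2.
have [Ll lL'] : L < lam /\ lam < L' by rewrite /lam; split; lra.
have fF : finite_mean F.
  split=> //; first by rewrite [X in (X < _)%E]probability_setT ltry.
  by rewrite /mass [X in fine X]probability_setT.
have fMF : finite_mean (mscale M F) by exact: finite_mean_scale.
have fM'F : finite_mean (mscale M' F).
  by apply: finite_mean_scale => //; exact: lt_trans MM'.
have k1 : 1 < M'%:num / M%:num by rewrite ltr_pdivlMr// mul1r.
pose k := NngNum (ltW (lt_trans ltr01 k1)).
have M'E : mscale M' F = mscale k (mscale M F) :> borel_measure R.
  apply: measure_ext => U.
  change (M'%:num%:E * F U = k%:num%:E * (M%:num%:E * F U))%E.
  by rewrite muleA -EFinM /= divfK// gt_eqF.
have kl := known_point lam; have [fl _] := kl.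
have [[arm1 _] _] := bL lam; have [_ [arm2 _]] := bL' lam.
have : lam >= L'; last by rewrite leNgt lL'.
apply: arm2; apply/le_anti/andP; split; last exact: W2_le_W.
apply: le_trans (W2_ge pA rA fM'F kl).
have <- : W A (mscale M F) (point lam) =
    tail_sum A 0 * lam.
  apply: not_arm1_optimal_W => // opt1.
  by have := arm1 opt1; rewrite leNgt Ll.
by rewrite M'E; exact: scaling_decreasing_W.
Qed.
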